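(* Let $\tilde h$ and $\mathcal F$ be as defined in the context, and let $u$ be the solution of the hyperbolic problem $$c(\mathbf{x})u_{tt}-\Delta u=a(\mathbf{x})u+B(\mathbf{x})\cdot\nabla u+p(\mathbf{x})h(\mathbf{x},t)\ \text{ in }\mathbb{R}^d\times(0,\infty),\qquad u(\mathbf{x},0)=f(\mathbf{x}),\quad u_t(\mathbf{x},0)=g(\mathbf{x})\ \text{ for }\mathbf{x}\in\mathbb{R}^d.$$ Then the function $$w(\mathbf{x},t)=\frac{u_{tt}(\mathbf{x},t)}{\tilde h(\mathbf{x},t)}\qquad\text{for all }(\mathbf{x},t)\in\Omega\times[0,T]$$ satisfies $$\mathcal{L}w=\mathcal{F}(\mathbf{x},t)\qquad(\mathbf{x},t)\in\Omega\times[0,T],$$ where $$\mathcal{L}\phi=c(\mathbf{x})\phi_{tt}-\Delta\phi-L(\phi,\nabla\phi,\phi_t)+\frac{c(\mathbf{x})h_{tt}(\mathbf{x},t)}{\tilde h(\mathbf{x},t)}\int_0^t\phi_t(\mathbf{x},\tau)\,d\tau$$ for all functions $\phi$. Furthermore, $$w_t(\mathbf{x},0)=\Psi(\mathbf{x}),$$ where $$\Psi(\mathbf{x})=\frac{(\Delta g(\mathbf{x})+B(\mathbf{x})\cdot\nabla g(\mathbf{x}))\,h(\mathbf{x},0)-(\Delta f(\mathbf{x})+B(\mathbf{x})\cdot\nabla f(\mathbf{x}))}{c(\mathbf{x})h^2(\mathbf{x},0)}$$ for all $\mathbf{x}\in\Omega$, and $$w(\mathbf{x},t)=\zeta(\mathbf{x},t)\quad\text{and}\quad\partial_\nu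 w(\mathbf{x},t)=\xi(\mathbf{x},t)\qquad\text{for all }(\mathbf{x},t)\in\partial\Omega\times[0,T],$$ where $$\zeta(\mathbf{x},t)=\frac{F_{tt}(\mathbf{x},t)}{\tilde h(\mathbf{x},t)}\quad\text{and}\quad\xi(\mathbf{x},t)=\frac{G_{tt}(\mathbf{x},t)\tilde h(\mathbf{x},t)-\partial_\nu\tilde h(\mathbf{x},t)F_{tt}(\mathbf{x},t)}{\tilde h^2(\mathbf{x},t)}.$$
   Context: $d\ge2$ is the spatial dimension and $[s]$ is the integer part of $s\in\mathbb{R}$. The known coefficients are $a,c\in C^{[(d+1)/2]+3}(\mathbb{R}^d)$ and $B\in C^{[(d+1)/2]+3}(\mathbb{R}^d,\mathbb{R}^d)$; the functions $c-1$, $a$ and $B$ are compactly supported. The functions $f,g\in H^{[(d+1)/2+5]}(\mathbb{R}^d)$ have compact supports. The function $h:\mathbb{R}^d\times[0,\infty)\to\mathbb{R}$ is such that $h(\cdot,t)\in C^{[(d+1)/2]+1}(\mathbb{R}^d)$ for all $t>0$ and $h(\mathbf{x},\cdot)\in C^3([0,\infty))$ for all $\mathbf{x}\in\mathbb{R}^d$. The source $p=p(\mathbf{x})$ is a function of $\mathbf{x}$ only. It is stated that these conditions guarantee that the solution $u$ exists uniquely and belongs to $C^4(\mathbb{R}^d)$. $\Omega\subset\mathbb{R}^d$ is a piecewise smooth bounded domain, $\partial_\nu$ denotes the normal derivative on $\partial\Omega$, and $T>0$ is large enough. It is assumed that $|h(\mathbf{x},0)|>0$ for all $\mathbf{x}\in\Omega$.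 The lateral Cauchy data are $F(\mathbf{x},t)=u(\mathbf{x},t)$ and $G(\mathbf{x},t)=\partial_\nu u(\mathbf{x},t)$ for $(\mathbf{x},t)\in\partial\Omega\times[0,T]$. $\tilde h$ is a smooth function on $\Omega\times[0,\infty)$ satisfying $\tilde h(\mathbf{x},0)=h(\mathbf{x},0)$, $\tilde h_t(\mathbf{x},0)=h_t(\mathbf{x},0)$ and $\tilde h(\mathbf{x},t)\neq0$ for all $\mathbf{x}\in\Omega$ and $t\in[0,T]$. The lower-order expression $L$ is $$L(\phi,\nabla\phi,\phi_t)=\frac{a(\mathbf{x})\tilde h\phi+B(\mathbf{x})\cdot\nabla(\tilde h\phi)}{\tilde h}+c(\mathbf{x})\Big(\Big(\frac1{\tilde h}\Big)_{tt}\tilde h+\frac{h_{tt}}{\tilde h}\Big)\phi+2c(\mathbf{x})\Big(\frac1{\tilde h}\Big)_t(\tilde h\phi)_t-\Delta\Big(\frac1{\tilde h}\Big)\tilde h\phi-2\nabla\Big(\frac1{\tilde h}\Big)\cdot\nabla(\tilde h\phi),$$ where $\tilde h$, $h_{tt}$ and $\phi$ are evaluated at $(\mathbf{x},t)$, and $$\mathcal{F}(\mathbf{x},t)=-\frac{h_{tt}(\mathbf{x},t)\big(\Delta f(\mathbf{x})+a(\mathbf{x})f(\mathbf{x})+B(\mathbf{x})\cdot\nabla f(\mathbf{x})\big)}{h(\mathbf{x},0)\,\tilde h(\mathbf{x},t)}.$$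
   Formalization: The printed Ψ is false in general; here Ψ = [(Δg+ag+B·∇g)h(x,0) − (Δf+af+B·∇f)h_t(x,0)]/(c h²(x,0)). Also c>0, h̃ is smooth and nonzero up to ∂Ω, and ∂_ν w = ξ is stated at smooth points of ∂Ω. *)

(* Defs.v *)
From HB Require Import structures.
From mathcomp Require Import all_boot all_order all_algebra.
From mathcomp Require Import all_classical all_reals all_analysis.

Set Implicit Arguments.
Unset Strict Implicit.
Unset Printing Implicit Defensive.

Import Order.TTheory GRing.Theory Num.Theory.
Import numFieldNormedType.Exports.

Local Open Scope classical_set_scope.
Local Open Scope ring_scope.

Section ProductMeasureOnTuples.
Context d (T : measurableType d) (R : realType) (n : nat).
Variables (m : {sigma_finite_measure set T -> \bar R})
          (mu : {sigma_finite_measure set (n.-tuple T) -> \bar R}).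

Definition tuple_of_pair (p : T * n.-tuple T) : n.+1.-tuple T :=
  [tuple of p.1 :: p.2].

Lemma measurable_tuple_of_pair :
  measurable_fun [set: T * n.-tuple T] tuple_of_pair.
Proof. exact: measurable_cons. Qed.

Definition cons_measure : set (n.+1.-tuple T) -> \bar R :=
  pushforward (m \x mu)%E tuple_of_pair.

Let cons_measure0 : cons_measure set0 = 0%E.
Proof. by rewrite /cons_measure /pushforward preimage_set0 measure0. Qed.

Let cons_measure_ge0 A : (0 <= cons_measure A)%E.
Proof. by rewrite /cons_measure /pushforward measure_ge0. Qed.

Let cons_measure_sigma_additive : semi_sigma_additive cons_measure.
Proof.
move=> F mF tF mUF; rewrite /cons_measure /pushforward preimage_bigcup.
have mpre A : measurable A -> measurable (tuple_of_pair @^-1` A).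
  move=> mA; rewrite -[X in measurable X]setTI.
  exact: measurable_tuple_of_pair.
apply: measure_semi_sigma_additive.
- by move=> i; exact: mpre.
- apply/trivIsetP => /= i j _ _ ij; rewrite -preimage_setI.
  by move/trivIsetP : tF => /(_ _ _ _ _ ij) ->//; rewrite preimage_set0.
- by rewrite -preimage_bigcup; exact: mpre.
Qed.

HB.instance Definition _ := isMeasure.Build _ _ _ cons_measure
  cons_measure0 cons_measure_ge0 cons_measure_sigma_additive.

Let cons_measure_sigma_finite : sigma_finite setT cons_measure.
Proof.
have /sigma_finiteP[F [FT ndF Foo]] := sigma_finiteT m.
have /sigma_finiteP[G [GT ndG Goo]] := sigma_finiteT mu.
pose uncons (t : n.+1.-tuple T) : T * n.-tuple T :=
  (thead t, [tuple of behead t]).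
have muncons : measurable_fun [set: n.+1.-tuple T] uncons.
  apply/measurable_fun_pairP; split; first exact: measurable_tnth.
  exact: measurable_behead.
have unconsK : uncons \o tuple_of_pair = id.
  by apply/funext => -[x t]; congr pair; apply/val_inj.
exists (fun i => uncons @^-1` (F i `*` G i)) => [|i].
  rewrite -preimage_bigcup -(preimage_setT uncons); congr preimage.
  apply/seteqP; split=> [[x y] _|//].
  have : [set: T] x by []. rewrite FT => -[i _ Fx].
  have : [set: n.-tuple T] y by []. rewrite GT => -[j _ Gy].
  exists (maxn i j) => //; split => /=.
    by move: Fx; exact/subsetPset/ndF/leq_maxl.
  by move: Gy; exact/subsetPset/ndG/leq_maxr.
have [mF Fi] := Foo i; have [mG Gi] := Goo i; split.
  by rewrite -[X in measurable X]setTI; apply: muncons => //; exact: measurableX.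
rewrite /cons_measure /pushforward -comp_preimage unconsK preimage_id.
by rewrite product_measure1E// lte_mul_pinfty// ge0_fin_numE.
Qed.

HB.instance Definition _ := @Measure_isSigmaFinite.Build _ _ _ cons_measure
  cons_measure_sigma_finite.

End ProductMeasureOnTuples.

(* Lebesgue measure on R^n, carried by n-tuples because these, unlike row
   vectors, have a measurable structure in the library. *)
Fixpoint lebesgue_tuple (R : realType) n :
    {sigma_finite_measure set (n.-tuple (measurableTypeR R)) -> \bar R} :=
  match n with
  | 0 => \d_([tuple] : 0.-tuple (measurableTypeR R))
  | n'.+1 => cons_measure (@lebesgue_measure R) (lebesgue_tuple R n')
  end.

Section Regularity.
Context {R : realType} {V W : normedModType R}.

(* For finite-dimensional V and open U, this is the usual class C^k(U):
   continuity of the directional derivatives in all directions is the same as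
   continuity of the partial derivatives. *)
Fixpoint Ck_open (U : set V) (k : nat) (f : V -> W) : Prop :=
  (forall x, U x -> {for x, continuous f}) /\
  match k with
  | 0 => True
  | k'.+1 => forall v, (forall x, U x -> derivable f x v) /\
                       Ck_open U k' ('D_v f)
  end.

(* C^k on a set A which need not be open: f agrees on A with a function that is
   C^k on a neighbourhood of A. The values of f outside A are irrelevant. *)
Definition Ck_on (A : set V) (k : nat) (f : V -> W) : Prop :=
  exists (U : set V) (F : V -> W),
    [/\ open U, A `<=` U, Ck_open U k F & forall x, A x -> F x = f x].

Definition smooth_on (A : set V) (f : V -> W) : Prop := forall k, Ck_on A k f.

(* The derivative of f at x in the direction v, computed from the values of f
   on A only: one-sided when A contains x + s v for just one sign of s. *)
Definition derive_within (A : set V) (f : V -> W) (x v : V) : W :=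
  lim ((fun s : R => s^-1 *: (f (x + s *: v) - f x))
         @ within [set s | A (x + s *: v)] 0^').

End Regularity.

Section Euclidean.
Context {R : realType} {d : nat}.
Local Notation E := 'rV[R]_d.

Definition dot (v w : E) : R := \sum_(i < d) v 0 i * w 0 i.

Definition partial (i : 'I_d) (phi : E -> R) : E -> R :=
  'D_(delta_mx 0 i) phi.

Definition grad (phi : E -> R) (x : E) : E := \row_i partial i phi x.

Definition laplacian (phi : E -> R) (x : E) : R :=
  \sum_(i < d) partial i (partial i phi) x.

Definition compactly_supported (phi : E -> R) : Prop :=
  compact (closure [set x | phi x != 0]).

(* Time runs over [0, oo): the derivative at t = 0 is the right derivative. *)
Definition dt (phi : E -> R -> R) (x : E) (t : R) : R :=
  derive_within [set s : R | 0 <= s] (phi x) t 1.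

Definition row_of_tuple (t : d.-tuple (measurableTypeR R)) : E :=
  \row_i tnth t i.

Definition integral_Rd (phi : E -> R) : R :=
  \int[lebesgue_tuple R d]_t phi (row_of_tuple t).

Definition L2 (phi : E -> R) : Prop :=
  (phi \o row_of_tuple) \in Lfun (lebesgue_tuple R d) 2%:E.

Definition test_function (phi : E -> R) : Prop :=
  (forall k, Ck_open setT k phi) /\ compactly_supported phi.

(* The sequence s of coordinates plays the role of a multi-index of order
   size s. *)
Definition iter_partial (s : seq 'I_d) (phi : E -> R) : E -> R :=
  foldr partial phi s.

Definition weak_derivative (s : seq 'I_d) (phi psi : E -> R) : Prop :=
  forall theta, test_function theta ->
    integral_Rd (fun x => phi x * iter_partial s theta x) =
    (-1) ^+ size s * integral_Rd (fun x => psi x * theta x).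

Definition sobolev_H (k : nat) (phi : E -> R) : Prop :=
  L2 phi /\ forall s : seq 'I_d, (size s <= k)%N ->
    exists psi, L2 psi /\ weak_derivative s phi psi.

Definition boundary (Omega : set E) : set E := closure Omega `\` interior Omega.

(* Near x, Omega is the sublevel set {rho < 0} of a smooth function rho whose
   gradient at x is a positive multiple of the unit vector n. *)
Definition outward_unit_normal (Omega : set E) (x n : E) : Prop :=
  dot n n = 1 /\
  exists (U : set E) (rho : E -> R) (lambda : R),
    [/\ open U, U x & forall k, Ck_open U k rho] /\
    [/\ forall y, U y -> (Omega y <-> rho y < 0),
        rho x = 0, 0 < lambda & grad rho x = lambda *: n].

Definition smooth_boundary (Omega : set E) : set E :=
  [set x | exists n, outward_unit_normal Omega x n].

Definition codim2_submanifold (S : set E) : Prop :=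
  forall x, S x -> exists (U : set E) (rho sigma : E -> R),
    [/\ open U, U x, forall k, Ck_open U k rho & forall k, Ck_open U k sigma] /\
    (forall y, U y -> (S y <-> rho y = 0 /\ sigma y = 0)) /\
    (forall alpha beta : R, alpha *: grad rho x + beta *: grad sigma x = 0 ->
       alpha = 0 /\ beta = 0).

(* The boundary is a smooth hypersurface except on edges and corners, which lie
   on finitely many submanifolds of codimension two. *)
Definition piecewise_smooth_boundary (Omega : set E) : Prop :=
  boundary Omega `<=` closure (smooth_boundary Omega) /\
  exists (m : nat) (S : 'I_m -> set E),
    (forall i, codim2_submanifold (S i)) /\
    forall x, boundary Omega x -> ~ smooth_boundary Omega x -> exists i, S i x.

Definition piecewise_smooth_bounded_domain (Omega : set E) : Prop :=
  [/\ open Omega, connected Omega, Omega !=set0, bounded_set Omega &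
      piecewise_smooth_boundary Omega].

(* The derivative at a boundary point is taken from inside, so it makes sense
   for functions given on the closure of Omega only. *)
Definition normal_derivative (Omega : set E) (nu : E -> E) (phi : E -> R)
    (x : E) : R :=
  derive_within (closure Omega) phi x (nu x).

End Euclidean.

Section Problem.
Context {R : realType} {d : nat}.
Local Notation E := 'rV[R]_d.
Variables (a c : E -> R) (B : E -> E).

Definition solves_hyperbolic (f g p : E -> R) (h u : E -> R -> R) : Prop :=
  [/\ forall x t, 0 < t ->
        c x * dt (dt u) x t - laplacian (u^~ t) x =
        a x * u x t + dot (B x) (grad (u^~ t) x) + p x * h x t,
      forall x, u x 0 = f x &
      forall x, dt u x 0 = g x].

Variables (h ht : E -> R -> R).

Let iht (x : E) (t : R) : R := (ht x t)^-1.

Definition lower_order (phi : E -> R -> R) (x : E) (t : R) : R :=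
  let hphi := fun y s => ht y s * phi y s in
  (a x * ht x t * phi x t + dot (B x) (grad (hphi^~ t) x)) / ht x t
  + c x * (dt (dt iht) x t * ht x t + dt (dt h) x t / ht x t) * phi x t
  + 2 * c x * dt iht x t * dt hphi x t
  - laplacian (iht^~ t) x * ht x t * phi x t
  - 2 * dot (grad (iht^~ t) x) (grad (hphi^~ t) x).

Definition calL (phi : E -> R -> R) (x : E) (t : R) : R :=
  c x * dt (dt phi) x t - laplacian (phi^~ t) x - lower_order phi x t
  + c x * dt (dt h) x t / ht x t
    * \int[lebesgue_measure]_(tau in `[0, t]) dt phi x tau.

Definition calF (f : E -> R) (x : E) (t : R) : R :=
  - (dt (dt h) x t * (laplacian f x + a x * f x + dot (B x) (grad f x)))
  / (h x 0 * ht x t).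

(* From c u_tt(0) = Delta f + a f + B . grad f + p h(0) and
   c u_ttt(0) = Delta g + a g + B . grad g + p h_t(0), the terms in p cancel in
   w_t(0) = (u_ttt(0) h(0) - u_tt(0) h_t(0)) / h(0)^2. In particular the terms
   a g and a f and the factor h_t(0) cannot be dropped. *)
Definition Psi (f g : E -> R) (x : E) : R :=
  ((laplacian g x + a x * g x + dot (B x) (grad g x)) * h x 0
   - (laplacian f x + a x * f x + dot (B x) (grad f x)) * dt h x 0)
  / (c x * h x 0 ^+ 2).

Definition zeta (F : E -> R -> R) (x : E) (t : R) : R :=
  dt (dt F) x t / ht x t.

Definition xi (Omega : set E) (nu : E -> E) (F G : E -> R -> R) (x : E)
    (t : R) : R :=
  (dt (dt G) x t * ht x t
   - normal_derivative Omega nu (ht^~ t) x * dt (dt F) x t) / ht x t ^+ 2.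

End Problem.

(* Main.v *)
Require Import Defs.
From mathcomp Require Import all_boot all_order all_algebra.
From mathcomp Require Import all_classical all_reals all_analysis.
From mathcomp Require Import ring lra.

Import Order.TTheory GRing.Theory Num.Theory.
Import numFieldNormedType.Exports.

Local Open Scope classical_set_scope.
Local Open Scope ring_scope.

(* Differentiating the equation twice in time gives
     c V_tt - Delta V = a V + B . grad V + p h_tt   for V = u_tt.
   Substituting V = ht w turns this into an equation for w whose source is
   p h_tt / ht; the equation at t = 0 eliminates p in favour of f and of
   w(x, 0) = w(x, t) - int_0^t w_t, which produces the integral term. The
   functions of (x, t) are only regular on sets with boundary, so each of them
   is replaced by a C^k extension to an open subset of space-time, on which time
   and space derivatives are directional derivatives and commute. *)

Set Implicit Arguments.
Unset Strict Implicit.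

(** * Directional derivatives along lines *)

(** Three obstacles shape the proof. The class [Ck_open] only speaks of continuous directional
    derivatives, so neither the symmetry of second derivatives nor the additivity of ['D_v f] in [v]
    is built in; both are drawn from the mean value theorem. No regularity is assumed of [p], so the
    source [p h] can be differentiated in time only, at a fixed [x]. Finally, the equation is given
    for [t > 0] and says nothing about the extension of [u] at negative times: [t = 0] is reached by
    continuity, and an identity on the closed half-line is differentiated there through one-sided
    limits. *)

Section Distances.
Context {R : realType}.
Implicit Types a b c e : R.

Lemma dist_le2 a b a' b' e : `|a - a'| < e / 2 -> `|b - b'| < e / 2 -> b' = a' ->
  `|a - b| <= e.
Proof.
move=> + + E; rewrite {}E !ltr_norml => /andP[? ?] /andP[? ?].
by rewrite ler_norml; apply/andP; split; lra.
Qed.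

Lemma dist_le3 a b c a' b' c' e : `|a - a'| < e / 3 -> `|b - b'| < e / 3 ->
  `|c - c'| < e / 3 -> c' = a' + b' -> `|c - (a + b)| <= e.
Proof.
move=> + + + E; rewrite {}E !ltr_norml => /andP[? ?] /andP[? ?] /andP[? ?].
by rewrite ler_norml; apply/andP; split; lra.
Qed.

End Distances.

Section Lines.
Context {R : realType} {V : normedModType R}.
Implicit Types (f : V -> R) (x v w : V).

Lemma is_derive_line f x v (s : R) : derivable f (x + s *: v) v ->
  is_derive s 1 (fun r : R => f (x + r *: v)) ('D_v f (x + s *: v)).
Proof.
have E : (fun h : R => h^-1 *: (((fun r : R => f (x + r *: v)) \o shift s) (h *: 1)
      - f (x + s *: v))) =
    (fun h : R => h^-1 *: ((f \o shift (x + s *: v)) (h *: v) - f (x + s *: v))).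
  apply/funext => h /=; congr (_ *: (f _ - _)).
  by rewrite -[h *: 1]/(h * 1) mulr1 scalerDl addrCA.
by move=> df; split; rewrite /derivable /derive E.
Qed.

Lemma MVT_line f x v (s : R) : 0 < s ->
  (forall r, 0 <= r <= s -> derivable f (x + r *: v) v) ->
  exists2 r, 0 < r < s & f (x + s *: v) - f x = s * 'D_v f (x + r *: v).
Proof.
move=> s0 df.
have dl r : 0 <= r <= s -> is_derive r 1 (fun r : R => f (x + r *: v)) ('D_v f (x + r *: v)).
  by move=> rs; apply: is_derive_line; exact: df.
have [||r] := @MVT R (fun r => f (x + r *: v)) (fun r => 'D_v f (x + r *: v)) 0 s s0.
- move=> r; rewrite in_itv /= => /andP[r0 rs]; apply: dl.
  by rewrite !ltW.
- apply: derivable_within_continuous => r; rewrite in_itv /= => rs.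
  by have [] := dl r rs.
rewrite in_itv /= scale0r addr0 subr0 => rs ->; exists r => //.
by rewrite mulrC.
Qed.

Lemma near_parallelogram (P : set V) x v w : nbhs x P ->
  exists2 r : R, 0 < r & forall p q, `|p| <= r -> `|q| <= r -> P (x + p *: v + q *: w).
Proof.
move=> /nbhs_normP[e /= e0 eP].
have D0 : 0 < `|v| + `|w| + 1 by rewrite ltr_wpDl// addr_ge0.
(* The displacement is at most [r * (|v| + |w|)]; the summand 1 makes this strictly less than [e]
   and keeps the denominator positive when [v = w = 0]. *)
exists (e / (`|v| + `|w| + 1)); first by rewrite divr_gt0.
move=> p q pr qr; apply: eP; rewrite /= -addrA opprD addrA subrr sub0r normrN.
rewrite (le_lt_trans (ler_normD _ _))// !normrZ.
rewrite (@le_lt_trans _ _ (e / (`|v| + `|w| + 1) * (`|v| + `|w|)))//.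
  by rewrite mulrDr lerD// ler_wpM2r.
by rewrite -mulrA gtr_pMr// mulrC ltr_pdivrMr// mul1r ltrDl.
Qed.

(** Two mean value steps: one along [v] for the increment of [f] in the direction [w], then one
    along [w] for ['D_v f]. The left-hand side is symmetric in [v] and [w] while the right-hand side
    is not, which is what the symmetry of second derivatives needs. *)
Lemma second_difference f x v w (s : R) : 0 < s ->
  (forall p q, 0 <= p <= s -> 0 <= q <= s ->
     derivable f (x + p *: v + q *: w) v /\
     derivable ('D_v f) (x + p *: v + q *: w) w) ->
  exists p q, [/\ 0 < p < s, 0 < q < s &
    f (x + s *: v + s *: w) - f (x + s *: v) - f (x + s *: w) + f x =
    s * s * 'D_w ('D_v f) (x + p *: v + q *: w)].
Proof.
move=> s0 df.
have s00 : 0 <= (0 : R) <= s by rewrite lexx ltW.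
have s01 : 0 <= s <= s by rewrite lexx ltW.
have dl r : 0 <= r <= s ->
    is_derive r 1 (fun r : R => f (x + s *: w + r *: v) - f (x + r *: v))
      ('D_v f (x + s *: w + r *: v) - 'D_v f (x + r *: v)).
  move=> rs; apply: is_deriveB; apply: is_derive_line.
    by rewrite addrAC; have [] := df _ _ rs s01.
  by have [] := df _ _ rs s00; rewrite scale0r addr0.
have [||p] := @MVT R (fun r => f (x + s *: w + r *: v) - f (x + r *: v))
  (fun r => 'D_v f (x + s *: w + r *: v) - 'D_v f (x + r *: v)) 0 s s0.
- move=> r; rewrite in_itv /= => /andP[r0 rs]; apply: dl.
  by rewrite !ltW.
- apply: derivable_within_continuous => r; rewrite in_itv /= => rs.
  by have [] := dl r rs.
rewrite in_itv/= => ps; rewrite scale0r !addr0 subr0 => E.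
have [|q qs E'] := @MVT_line ('D_v f) (x + p *: v) w s s0.
  by move=> r rs; have [] := df p r _ rs; first by case/andP : ps => *; rewrite !ltW.
exists p, q; split => //.
rewrite -mulrA -E'.
by rewrite (addrAC x (p *: v)) mulrC -E (addrAC x (s *: v)); ring.
Qed.

(** Evaluating the same second difference in both orders gives equal values of the two mixed
    derivatives at two points of a small parallelogram; by continuity each is within [e / 2] of its
    value at [x]. *)
Lemma derivative_symmetric f (U : set V) x v w : open U -> U x -> Ck_open U 2 f ->
  'D_v ('D_w f) x = 'D_w ('D_v f) x.
Proof.
move=> oU Ux [_ C].
have [dv [_ C2v]] := C v; have [dw [_ C2w]] := C w.
have [dvw [cvw _]] := C2v w; have [dwv [cwv _]] := C2w v.
have nU : nbhs x U by exact: open_nbhs_nbhs.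
apply/eqP; rewrite -subr_eq0 -normr_le0; apply/ler_addgt0Pr => e e0; rewrite add0r.
have e20 : 0 < e / 2 by rewrite divr_gt0.
have /cvgrPdist_lt/(_ _ e20) n1 := cvw x Ux.
have /cvgrPdist_lt/(_ _ e20) n2 := cwv x Ux.
have [r r0 rP] := @near_parallelogram _ x v w (filterI nU (filterI n1 n2)).
have rP' p q : 0 <= p <= r -> 0 <= q <= r -> [/\ U (x + p *: v + q *: w),
   `|'D_w ('D_v f) x - 'D_w ('D_v f) (x + p *: v + q *: w)| < e / 2 &
   `|'D_v ('D_w f) x - 'D_v ('D_w f) (x + p *: v + q *: w)| < e / 2].
  move=> /andP[p0 pr] /andP[q0 qr].
  have [Uy [y1 y2]] := rP p q ltac:(by rewrite ger0_norm) ltac:(by rewrite ger0_norm).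
  by split; [exact: Uy|exact: y1|exact: y2].
have [|p [q [/andP[p0 pr] /andP[q0 qr] E]]] := @second_difference f x v w r r0.
  by move=> p q pr qr; have [Uy _ _] := rP' _ _ pr qr; split; [exact: dv|exact: dvw].
have [|p' [q' [/andP[p0' pr'] /andP[q0' qr'] E']]] := @second_difference f x w v r r0.
  move=> p1 q1 pr1 qr1; rewrite addrAC; have [Uy _ _] := rP' _ _ qr1 pr1.
  by split; [exact: dw|exact: dwv].
have {E'}E' : 'D_w ('D_v f) (x + p *: v + q *: w) = 'D_v ('D_w f) (x + q' *: v + p' *: w).
  have rr : r * r != 0 by rewrite mulf_neq0// gt_eqF.
  apply: (mulfI rr); rewrite -E (addrAC x (q' *: v)) -E' (addrAC x (r *: w)); ring.
have [||_ A _] := rP' p q; [by rewrite !ltW..|].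
have [||_ _ A'] := rP' q' p'; [by rewrite !ltW..|].
exact: dist_le2 A' A E'.
Qed.

(** The increment of [f] along the diagonal [r (v + w)] is the sum of the increments along [r v] and
    then [r w]. The mean value theorem on the three sides of this triangle, with continuity of the
    three derivatives, gives additivity up to any [e]. *)
Lemma deriveDdir f (U : set V) x v w : open U -> U x -> Ck_open U 1 f ->
  'D_(v + w) f x = 'D_v f x + 'D_w f x.
Proof.
move=> oU Ux [_ C].
have [dv [cv _]] := C v; have [dw [cw _]] := C w; have [dvw _] := C (v + w).
have nU : nbhs x U by exact: open_nbhs_nbhs.
apply/eqP; rewrite -subr_eq0 -normr_le0; apply/ler_addgt0Pr => e e0; rewrite add0r.
have e30 : 0 < e / 3 by rewrite divr_gt0.
have /cvgrPdist_lt/(_ _ e30) n1 := cv x Ux.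
have /cvgrPdist_lt/(_ _ e30) n2 := cw x Ux.
have [_ [cvw _]] := C (v + w).
have /cvgrPdist_lt/(_ _ e30) n3 := cvw x Ux.
have [r r0 rP] := @near_parallelogram _ x v w (filterI nU (filterI n1 (filterI n2 n3))).
have rP' p q : 0 <= p <= r -> 0 <= q <= r -> [/\ U (x + p *: v + q *: w),
   `|'D_v f x - 'D_v f (x + p *: v + q *: w)| < e / 3,
   `|'D_w f x - 'D_w f (x + p *: v + q *: w)| < e / 3 &
   `|'D_(v + w) f x - 'D_(v + w) f (x + p *: v + q *: w)| < e / 3].
  move=> /andP[p0 pr] /andP[q0 qr].
  have [Uy [y1 [y2 y3]]] := rP p q ltac:(by rewrite ger0_norm) ltac:(by rewrite ger0_norm).
  by split; [exact: Uy|exact: y1|exact: y2|exact: y3].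
have [|a /andP[a0 ar] Ea] := @MVT_line f x v r r0.
  move=> p pr; have [|Uy _ _ _] := rP' p 0 pr; first by rewrite lexx ltW.
  by apply: dv; rewrite scale0r addr0 in Uy.
have [|b /andP[b0 br] Eb] := @MVT_line f (x + r *: v) w r r0.
  move=> p pr; have [|Uy _ _ _] := rP' r p _ pr; first by rewrite lexx ltW.
  exact: dw.
have [|c /andP[c0 cr] Ec] := @MVT_line f x (v + w) r r0.
  move=> p pr; have [Uy _ _ _] := rP' p p pr pr.
  by apply: dvw; rewrite scalerDr addrA.
have E : 'D_(v + w) f (x + c *: v + c *: w) =
    'D_v f (x + a *: v + 0 *: w) + 'D_w f (x + r *: v + b *: w).
  apply: (@mulfI _ r); first by rewrite gt_eqF.
  rewrite mulrDr scale0r addr0 -Ea -Eb -addrA -scalerDr -Ec scalerDr addrA; ring.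
have [||_ A _ _] := rP' a 0; [by rewrite ?lexx !ltW..|].
have [||_ _ A' _] := rP' r b; [by rewrite ?lexx !ltW..|].
have [||_ _ _ A''] := rP' c c; [by rewrite ?lexx !ltW..|].
exact: dist_le3 A A' A'' E.
Qed.

End Lines.

(** * Algebra of C^k functions *)

Section CkAlgebra.
Context {R : realType} {V : normedModType R}.
Implicit Types (f g : V -> R) (U : set V).

Lemma open_near U (P : V -> Prop) x : open U -> U x -> (forall y, U y -> P y) ->
  \forall y \near x, P y.
Proof. by move=> oU Ux UP; apply: filterS UP _; exact: open_nbhs_nbhs. Qed.

Lemma eq_derive_open U f g x v : open U -> U x -> (forall y, U y -> f y = g y) ->
  'D_v f x = 'D_v g x.
Proof. by move=> oU Ux fg; apply: near_eq_derive; exact: open_near fg. Qed.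

Lemma Ck_open_ext U k f g : open U -> (forall x, U x -> f x = g x) ->
  Ck_open U k f -> Ck_open U k g.
Proof.
move=> oU; elim: k f g => [|k IH] f g fg [cf Cf].
- split=> // x Ux; rewrite /prop_for /continuous_at -fg//.
  by apply: cvg_trans (cf _ Ux); apply: near_eq_cvg; exact: open_near fg.
- split=> [x Ux|v].
    rewrite /prop_for /continuous_at -fg//.
    by apply: cvg_trans (cf _ Ux); apply: near_eq_cvg; exact: open_near fg.
  have [df C] := Cf v; split => [x Ux|].
    by apply: near_eq_derivable (df _ Ux); exact: open_near fg.
  by apply: IH C => x Ux; exact: eq_derive_open fg.
Qed.

Lemma Ck_open_subset U U' k f : U' `<=` U -> Ck_open U k f -> Ck_open U' k f.
Proof.
move=> UU; elim: k f => [|k IH] f [cf Cf]; first by split=> // x /UU/cf.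
split => [x /UU/cf//|v].
by have [df C] := Cf v; split=> [x /UU/df//|]; exact: IH.
Qed.

Lemma Ck_open_pred U k f : Ck_open U k.+1 f -> Ck_open U k f.
Proof.
elim: k f => [|k IH] f [cf Cf]; [by []|split => // v].
by have [df C] := Cf v; split => //; exact: IH.
Qed.

Lemma Ck_open_le U m n f : (m <= n)%N -> Ck_open U n f -> Ck_open U m f.
Proof.
by move=> /subnK <-; elim: (n - m)%N => // k IH /= Cf; apply: IH; exact: Ck_open_pred.
Qed.

Lemma Ck_open_derive U k f v : Ck_open U k.+1 f -> Ck_open U k ('D_v f).
Proof. by case=> _ /(_ v)[]. Qed.

Lemma Ck_open_derivable U k f v x : Ck_open U k.+1 f -> U x -> derivable f x v.
Proof. by case=> _ /(_ v)[df _]; exact: df. Qed.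

Lemma Ck_open_continuous U k f x : Ck_open U k f -> U x -> {for x, continuous f}.
Proof. by case: k => [|k] [cf _]; exact: cf. Qed.

Lemma Ck_openN U k f : open U -> Ck_open U k f -> Ck_open U k (fun x => - f x).
Proof.
move=> oU; elim: k f => [|k IH] f [cf Cf].
- split=> // x Ux; apply: cvgN; exact: cf.
- split=> [x Ux|v].
    by apply: cvgN; exact: cf.
  have [df C] := Cf v; split => [x Ux|]; first by apply: derivableN; exact: df.
  apply: Ck_open_ext (IH _ C) => // x Ux.
  by rewrite deriveN//; exact: df.
Qed.

Lemma Ck_openD U k f g : open U -> Ck_open U k f -> Ck_open U k g ->
  Ck_open U k (fun x => f x + g x).
Proof.
move=> oU; elim: k f g => [|k IH] f g [cf Cf] [cg Cg].
- split=> // x Ux; apply: cvgD; [exact: cf|exact: cg].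
- split=> [x Ux|v].
    by apply: cvgD; [exact: cf|exact: cg].
  have [df C] := Cf v; have [dg C'] := Cg v; split => [x Ux|].
    by apply: derivableD; [exact: df|exact: dg].
  apply: Ck_open_ext (IH _ _ C C') => // x Ux.
  by rewrite deriveD//; [exact: df|exact: dg].
Qed.

Lemma Ck_openM U k f g : open U -> Ck_open U k f -> Ck_open U k g ->
  Ck_open U k (fun x => f x * g x).
Proof.
move=> oU; elim: k f g => [|k IH] f g Cf Cg.
- split=> // x Ux; apply: cvgM; [exact: Cf.1|exact: Cg.1].
- split=> [x Ux|v].
    by apply: cvgM; [exact: Cf.1|exact: Cg.1].
  split => [x Ux|].
    by apply: derivableM; [exact: (Ck_open_derivable Cf Ux)|exact: (Ck_open_derivable Cg Ux)].
  apply: (@Ck_open_ext _ _ (fun x => f x * 'D_v g x + g x * 'D_v f x)) => // [x Ux|].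
    by rewrite deriveM//; [exact: (Ck_open_derivable Cf Ux)|exact: (Ck_open_derivable Cg Ux)].
  by apply: Ck_openD => //; apply: IH;
    [exact: Ck_open_pred|exact: Ck_open_derive|exact: Ck_open_pred|exact: Ck_open_derive].
Qed.

(** The induction keeps [f] fixed: the derivative of [1/f] is a polynomial in [1/f] itself, known to
    be one class lower, and ['D_v f]. *)
Lemma Ck_openV U k f : open U -> (forall x, U x -> f x != 0) -> Ck_open U k f ->
  Ck_open U k (fun x => (f x)^-1).
Proof.
move=> oU f0; elim: k => [|k IH] Cf.
- split=> // x Ux; apply: cvgV; [exact: f0|exact: Cf.1].
- split=> [x Ux|v].
    by apply: cvgV; [exact: f0|exact: Cf.1].
  split => [x Ux|].
    by apply: derivableV; [exact: f0|exact: (Ck_open_derivable Cf Ux)].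
  have CV := IH (Ck_open_pred Cf).
  apply: (@Ck_open_ext _ _ (fun x => - ((f x)^-1 * (f x)^-1 * 'D_v f x))) => // [x Ux|].
    rewrite deriveV//; [|exact: f0|exact: (Ck_open_derivable Cf Ux)].
    by rewrite -[RHS]/(_ * _) mulNr -exprVn expr2.
  by apply: Ck_openN => //; apply: Ck_openM; [|exact: Ck_openM|exact: Ck_open_derive].
Qed.

End CkAlgebra.

(** * From one-sided to directional derivatives *)

Section Within.
Context {R : realType} {V : normedModType R}.
Implicit Types (A : set V) (f F : V -> R) (x v : V).

Lemma cvg_line x v : (fun s : R => x + s *: v) @ (0 : R) --> x.
Proof.
move=> P /(near_parallelogram 0 v)[r r0 rP].
exists r => //= s; rewrite /ball_/= sub0r normrN => sr.
by have := rP 0 s; rewrite scaler0 addr0 normr0; apply; exact: ltW.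
Qed.

(** Restricting a convergent difference quotient to the admissible steps keeps its limit, and
    properness of the restricted filter makes that limit the value of [lim]. *)
Lemma derive_withinE A f F x v :
  ProperFilter (within [set s : R | A (x + s *: v)] 0^') -> derivable F x v ->
  (\forall s \near (0 : R)^', A (x + s *: v) -> f (x + s *: v) = F (x + s *: v)) ->
  f x = F x -> derive_within A f x v = 'D_v F x.
Proof.
move=> PF dF fF fFx; apply: cvg_lim => //.
have cF : (fun s : R => s^-1 *: (F (x + s *: v) - F x)) @ 0^' --> 'D_v F x.
  have -> : (fun s : R => s^-1 *: (F (x + s *: v) - F x)) =
      (fun s : R => s^-1 *: ((F \o shift x) (s *: v) - F x)).
    by apply/funext => s /=; rewrite [x + _]addrC.
  exact: dF.
apply: cvg_trans; last exact: (cvg_within_filter [set s : R | A (x + s *: v)] cF).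
apply: near_eq_cvg; rewrite near_withinE; apply: filterS fF => s fF As.
by rewrite fF// fFx.
Qed.

End Within.

Section Slices.
Context {R : realType} {E : normedModType R}.
Implicit Types (Phi : E * R -> R) (x v : E) (t : R).

Let slice1E Phi x t v :
  (fun h : R => h^-1 *: (((fun y => Phi (y, t)) \o shift x) (h *: v) - Phi (x, t))) =
  (fun h : R => h^-1 *: ((Phi \o shift (x, t)) (h *: (v, 0)) - Phi (x, t))).
Proof.
apply/funext => h /=; congr (_ *: (Phi _ - _)).
by congr pair => /=; rewrite scaler0 add0r.
Qed.

Let slice2E Phi x t :
  (fun h : R => h^-1 *: (((fun s => Phi (x, s)) \o shift t) (h *: 1) - Phi (x, t))) =
  (fun h : R => h^-1 *: ((Phi \o shift (x, t)) (h *: (0, 1)) - Phi (x, t))).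
Proof.
apply/funext => h /=; congr (_ *: (Phi _ - _)).
by congr pair => /=; rewrite scaler0 add0r.
Qed.

Lemma derive_slice1 Phi x t v : 'D_v (fun y => Phi (y, t)) x = 'D_(v, 0) Phi (x, t).
Proof. by rewrite /derive slice1E. Qed.

Lemma derivable_slice1 Phi x t v :
  derivable Phi (x, t) (v, 0) -> derivable (fun y => Phi (y, t)) x v.
Proof. by rewrite /derivable slice1E. Qed.

Lemma derive_slice2 Phi x t : 'D_1 (fun s => Phi (x, s)) t = 'D_(0, 1) Phi (x, t).
Proof. by rewrite /derive slice2E. Qed.

Lemma derivable_slice2 Phi x t :
  derivable Phi (x, t) (0, 1) -> derivable (fun s => Phi (x, s)) t 1.
Proof. by rewrite /derivable slice2E. Qed.

Lemma cvg_slice1 x t : (fun y => (y, t)) @ x --> (x, t).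
Proof. exact: (cvg_pair (@cvg_id _ _) (cvg_cst t)). Qed.

Lemma cvg_slice2 x t : (fun s => (x, s)) @ t --> (x, t).
Proof. exact: (cvg_pair (cvg_cst x) (@cvg_id _ _)). Qed.

Lemma continuous_slice2 Phi x t :
  {for (x, t), continuous Phi} -> {for t, continuous (fun s => Phi (x, s))}.
Proof.
by move=> cPhi; apply: (@continuous_comp _ _ _ (fun s => (x, s)) Phi) => //; exact: cvg_slice2.
Qed.

Lemma near_slice1 (P : set (E * R)) x t :
  (\forall z \near (x, t), P z) -> \forall y \near x, P (y, t).
Proof.
by move=> nP; exact: (cvg_slice1 nP).
Qed.

Lemma near_slice2 (P : set (E * R)) x t :
  (\forall z \near (x, t), P z) -> \forall s \near t, P (x, s).
Proof.
by move=> nP; exact: (cvg_slice2 nP).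
Qed.

Lemma Rintegral_derive_slice (U : set (E * R)) Phi x t : open U -> Ck_open U 1 Phi ->
  0 <= t -> (forall s, 0 <= s <= t -> U (x, s)) ->
  \int[lebesgue_measure]_(s in `[0, t]) 'D_(0, 1) Phi (x, s) = Phi (x, t) - Phi (x, 0).
Proof.
move=> oU CPhi; rewrite le_eqVlt => /predU1P[<- _|t0 Us].
  by rewrite set_itv1 Rintegral_set1 subrr.
have dPhi s : 0 <= s <= t -> derivable (fun s => Phi (x, s)) s 1.
  by move=> /Us Uxs; apply: derivable_slice2; exact: (Ck_open_derivable CPhi Uxs).
have cPhi s : 0 <= s <= t -> {for s, continuous (fun s => Phi (x, s))}.
  by move=> /Us Uxs; apply: continuous_slice2; exact: (Ck_open_continuous CPhi Uxs).
have cD : {within `[0, t], continuous (fun s : R => 'D_(0, 1) Phi (x, s))}.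
  apply: continuous_in_subspaceT => s; rewrite inE/= in_itv/= => /Us Uxs.
  apply: (continuous_slice2 (Phi := 'D_(0, 1) Phi)).
  have C0 : Ck_open U 0 ('D_((0, 1) : E * R) Phi) by exact: Ck_open_derive CPhi.
   exact: (Ck_open_continuous C0 Uxs).
rewrite /Rintegral (@continuous_FTC2 _ _ (fun s => Phi (x, s)) 0 t)//.
- split=> [s||]; first by rewrite in_itv/= => /andP[? ?]; apply: dPhi; rewrite !ltW.
    by apply: cvg_at_right_filter; apply: cPhi; rewrite lexx ltW.
  by apply: cvg_at_left_filter; apply: cPhi; rewrite lexx ltW.
- by move=> s _; rewrite derive1E derive_slice2.
Qed.

End Slices.

Section Cylinders.
Context {R : realType} {d : nat}.
Local Notation E := 'rV[R]_d.
Implicit Types (N : set (E * R)) (phi psi : E -> R -> R) (Phi : E * R -> R).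

(* A relatively open set may contain points with t = 0, where [dt] is one-sided. *)
Definition slicewise_open N := forall x t, N (x, t) ->
  [/\ 0 <= t, \forall y \near x, N (y, t) & \forall s \near t, 0 <= s -> N (x, s)].

Definition agree N phi Phi := forall x t, N (x, t) -> phi x t = Phi (x, t).

Definition ei (i : 'I_d) : E * R := (delta_mx 0 i, 0).
Definition et : E * R := (0, 1).

Lemma within_ge0_proper (t : R) : 0 <= t ->
  ProperFilter (within [set s : R | [set r | 0 <= r] (t + s *: 1)] 0^').
Proof.
move=> t0; apply: Build_ProperFilter_ex.
move=> P; rewrite /within/= /dnbhs/within/= => nP.
move/nbhs_ballP : nP => [e /= e0 eP].
have e20 : 0 < e / 2 by rewrite divr_gt0.
exists (e / 2); apply: eP.
- by rewrite /ball/= sub0r normrN gtr0_norm// ltr_pdivrMr// mulr_natr mulr2n ltrDl.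
- by rewrite gt_eqF.
- by rewrite -[_ *: _]/(_ * _) mulr1 addr_ge0// ltW.
Qed.

Lemma dtE phi (F : R -> R) (x : E) (t : R) : 0 <= t -> derivable F t 1 ->
  (\forall s \near t, 0 <= s -> phi x s = F s) -> dt phi x t = 'D_1 F t.
Proof.
move=> t0 dF nF; apply: derive_withinE => //; first exact: within_ge0_proper.
- apply: nbhs_dnbhs.
  exact: (cvg_line (1 : R) nF).
- exact: (nbhs_singleton nF).
Qed.

(** The conclusion is an agreement on the same [N], so the lemma can be iterated to reach
    [dt (dt phi)], also at [t = 0]. *)
Lemma agree_dt N phi Phi : slicewise_open N -> agree N phi Phi ->
  (forall z, N z -> derivable Phi z et) -> agree N (dt phi) ('D_et Phi).
Proof.
move=> oN pP dP x t Nxt; have [t0 _ nt] := oN _ _ Nxt.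
rewrite (dtE (F := fun s => Phi (x, s)) t0) ?derive_slice2//.
- by apply: derivable_slice2; exact: dP.
- by apply: filterS nt => s Ns s0; exact/pP/Ns.
Qed.

Lemma agree_partial N phi Phi i : slicewise_open N -> agree N phi Phi ->
  agree N (fun x t => partial i (phi^~ t) x) ('D_(ei i) Phi).
Proof.
move=> oN pP x t Nxt; have [_ nx _] := oN _ _ Nxt.
rewrite /partial -derive_slice1; apply: near_eq_derive.
by apply: filterS nx => y; exact: pP.
Qed.

Lemma agree_grad N phi Phi : slicewise_open N -> agree N phi Phi ->
  forall x t, N (x, t) -> grad (phi^~ t) x = \row_i 'D_(ei i) Phi (x, t).
Proof.
by move=> oN pP x t Nxt; apply/rowP => i; rewrite !mxE (agree_partial i oN pP).
Qed.

Lemma agree_laplacian N phi Phi : slicewise_open N -> agree N phi Phi ->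
  agree N (fun x t => laplacian (phi^~ t) x)
    (fun z => \sum_i 'D_(ei i) ('D_(ei i) Phi) z).
Proof.
move=> oN pP x t Nxt; apply: eq_bigr => i _.
exact: (agree_partial i oN (agree_partial i oN pP)).
Qed.

End Cylinders.

(** * Linearity in the direction and product rules *)

Section Directions.
Context {R : realType} {V : normedModType R}.
Implicit Types (f : V -> R) (U : set V) (x v : V).

(** The chain rule with inner function [r * a] treats [a = 0] like any other factor, whereas
    rescaling the difference quotient would divide by [a]. *)
Lemma deriveZdir f x v (a : R) : derivable f x v -> 'D_(a *: v) f x = a * 'D_v f x.
Proof.
move=> df.
have d1 : is_derive (0 * a) 1 (fun r : R => f (x + r *: v)) ('D_v f x).
  rewrite mul0r -[in 'D_v f x](addr0 x) -[in 'D_v f _](scale0r v).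
  by apply: is_derive_line; rewrite scale0r addr0.
have d2 : is_derive (0 : R) 1 (fun r : R => r * a) a.
  rewrite (_ : (fun r => r * a) = a \*: id); last by apply/funext => r; rewrite mulrC.
  by apply: is_derive_eq; rewrite -[LHS]/(_ * _) mulr1.
have [_ E] := @is_derive1_comp R (fun r => f (x + r *: v)) (fun r => r * a) 0 _ _ d1 d2.
rewrite mulrC -{}E /derive.
set q := (X in X @ _); set q' := (X in _ = lim (X @ _)); suff -> : q = q' by [].
apply/funext => h; rewrite /q /q' /=.
rewrite -[h *: 1]/(h * 1) mulr1 addr0 mul0r scale0r addr0 scalerA.
by rewrite [_ + x]addrC.
Qed.

Lemma derive_sum_dir f U x n (a : 'I_n -> R) (v : 'I_n -> V) : open U -> U x -> Ck_open U 1 f ->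
  'D_(\sum_i a i *: v i) f x = \sum_i a i * 'D_(v i) f x.
Proof.
move=> oU Ux Cf; elim/big_rec2: _ => [|i y w _ <-]; first exact: derive0.
by rewrite (deriveDdir _ _ oU Ux Cf) deriveZdir//; exact: (Ck_open_derivable Cf Ux).
Qed.

Lemma derive_gt0_near f x v : derivable f x v -> 0 < 'D_v f x ->
  \forall s \near (0 : R)^', s < 0 -> f (x + s *: v) < f x.
Proof.
move=> df D0; 
have n0 : \forall s \near (0 : R)^', 0 < s^-1 *: (f (s *: v + x) - f x).
  have c : (fun s : R => s^-1 *: (f (s *: v + x) - f x)) @ (0 : R)^' --> 'D_v f x by exact: df.
  by have := cvgr_gt _ c; apply.
apply: filterS n0 => s /= + s0.
by rewrite -[_ *: _]/(_ * _) nmulr_rgt0 ?invr_lt0// subr_lt0 addrC.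
Qed.

Lemma derive_fadd f g x v : derivable f x v -> derivable g x v ->
  is_derive x v (fun y => f y + g y) ('D_v f x + 'D_v g x).
Proof. by move=> df dg; apply: is_deriveD; exact: derivableP. Qed.

Lemma derive_fsub f g x v : derivable f x v -> derivable g x v ->
  is_derive x v (fun y => f y - g y) ('D_v f x - 'D_v g x).
Proof. by move=> df dg; apply: is_deriveB; exact: derivableP. Qed.

Lemma derive_fmul f g x v : derivable f x v -> derivable g x v ->
  is_derive x v (fun y => f y * g y) (f x * 'D_v g x + g x * 'D_v f x).
Proof. by move=> df dg; apply: is_deriveM; exact: derivableP. Qed.

Lemma derive_fscale (a : R) f x v : derivable f x v ->
  is_derive x v (fun y => a * f y) (a * 'D_v f x).
Proof. by move=> df; apply: is_deriveZ; exact: derivableP. Qed.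

Lemma derive_fsum n (F : 'I_n -> V -> R) x v : (forall i, derivable (F i) x v) ->
  is_derive x v (fun y => \sum_i F i y) (\sum_i 'D_v (F i) x).
Proof.
move=> dF; rewrite (_ : (fun _ => _) = \sum_i F i).
  by apply: is_derive_sum => i; exact: derivableP.
by apply/funext => y; rewrite fct_sumE.
Qed.

Lemma Ck_open_cst U k (a : R) : open U -> Ck_open U k (fun _ : V => a).
Proof.
move=> oU; elim: k a => [|k IH] a.
  by split => // x _; exact: cvg_cst.
split=> [x _|v]; first exact: cvg_cst.
split => [x _|]; first exact: derivable_cst.
by apply: Ck_open_ext (IH 0) => // x _; rewrite derive_cst.
Qed.

Lemma Ck_open_sum U k n (F : 'I_n -> V -> R) : open U ->
  (forall i, Ck_open U k (F i)) -> Ck_open U k (fun x => \sum_i F i x).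
Proof.
move=> oU CF; elim: n F CF => [|n IH] F CF.
  by apply: Ck_open_ext (Ck_open_cst k 0 oU) => // x _; rewrite big_ord0.
apply: (@Ck_open_ext _ _ _ _ (fun x => F ord0 x + \sum_(i < n) F (lift ord0 i) x)) => //.
  by move=> x _; rewrite big_ord_recl.
by apply: Ck_openD => //; exact: IH.
Qed.

Lemma deriveM_second f g U x v : open U -> U x -> Ck_open U 2 f -> Ck_open U 2 g ->
  'D_v ('D_v (fun y => f y * g y)) x =
  f x * 'D_v ('D_v g) x + 2 * 'D_v f x * 'D_v g x + g x * 'D_v ('D_v f) x.
Proof.
move=> oU Ux Cf Cg.
rewrite (eq_derive_open (g := fun y => f y * 'D_v g y + g y * 'D_v f y) v oU Ux); last first.
  move=> y Uy.
  by rewrite deriveM//; [exact: (Ck_open_derivable Cf Uy)|exact: (Ck_open_derivable Cg Uy)].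
have df : derivable f x v by exact: (Ck_open_derivable Cf Ux).
have dg : derivable g x v by exact: (Ck_open_derivable Cg Ux).
have Cf1 : Ck_open U 1 ('D_v f) by exact: Ck_open_derive.
have ddf : derivable ('D_v f) x v by exact: (Ck_open_derivable Cf1 Ux).
have Cg1 : Ck_open U 1 ('D_v g) by exact: Ck_open_derive.
have ddg : derivable ('D_v g) x v by exact: (Ck_open_derivable Cg1 Ux).
have [d1 e1] := derive_fmul df ddg; have [d2 e2] := derive_fmul dg ddf.
have [_ ->] := derive_fadd d1 d2; rewrite e1 e2; ring.
Qed.

End Directions.

(** * The wave operator *)

Section Wave.
Context {R : realType} {d : nat}.
Local Notation E := 'rV[R]_d.
Variables (gamma alpha : R) (beta : 'I_d -> R) (O : set (E * R)).
Hypothesis oO : open O.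
Implicit Type Phi : E * R -> R.

(* The coefficients are frozen at one point of space, which makes the operator
   commute with the time derivative. *)
Definition wave Phi (z : E * R) : R :=
  gamma * 'D_et ('D_et Phi) z - \sum_i 'D_(ei i) ('D_(ei i) Phi) z
  - (alpha * Phi z + \sum_i beta i * 'D_(ei i) Phi z).

Lemma Ck_open_wave k Phi : Ck_open O k.+2 Phi -> Ck_open O k (wave Phi).
Proof.
move=> C2; have C1 := Ck_open_pred C2; have C0 := Ck_open_pred C1.
have Cc (a : R) := @Ck_open_cst R (E * R)%type O k a oO.
rewrite /wave.
apply: Ck_openD => //; [apply: Ck_openD => //|].
- by apply: Ck_openM => //; do 2! apply: Ck_open_derive.
- apply: Ck_openN => //; apply: Ck_open_sum => // i.
  by do 2! apply: Ck_open_derive.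
- apply: Ck_openN => //; apply: Ck_openD => //; first exact: Ck_openM.
  apply: Ck_open_sum => // i; apply: Ck_openM => //.
  exact: Ck_open_derive.
Qed.

(** With constant coefficients only the order of derivatives is at stake. The time derivative passes
    two space derivatives one at a time: first with ['D_(ei i) Phi] as the function, then with [Phi]
    on all of [O], under the outer space derivative. *)
Lemma derive_wave Phi z : O z -> Ck_open O 3 Phi ->
  'D_et (wave Phi) z = wave ('D_et Phi) z.
Proof.
move=> Oz C3; have C2 := Ck_open_pred C3.
have D1 k (F : E * R -> R) (v y : E * R) : O y -> Ck_open O k.+1 F -> derivable F y v.
  by move=> Oy CF; exact: (Ck_open_derivable CF Oy).
have S1 i y : O y -> 'D_et ('D_(ei i) Phi) y = 'D_(ei i) ('D_et Phi) y.
  by move=> Oy; exact: (derivative_symmetric et (ei i) oO Oy C2).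
have S2 i : 'D_et ('D_(ei i) ('D_(ei i) Phi)) z = 'D_(ei i) ('D_(ei i) ('D_et Phi)) z.
  have Ci : Ck_open O 2 ('D_(ei i) Phi) by exact: Ck_open_derive.
  apply: etrans (derivative_symmetric et (ei i) oO Oz Ci) _.
  exact: (eq_derive_open (ei i) oO Oz (S1 i)).
have Ct : Ck_open O 2 ('D_et Phi) := Ck_open_derive et C3.
have Ctt : Ck_open O 1 ('D_et ('D_et Phi)) := Ck_open_derive et Ct.
have Ci i : Ck_open O 2 ('D_(ei i) Phi) := Ck_open_derive (ei i) C3.
have Cii i : Ck_open O 1 ('D_(ei i) ('D_(ei i) Phi)) := Ck_open_derive (ei i) (Ci i).
have da : derivable ('D_et ('D_et Phi)) z et := D1 _ _ _ _ Oz Ctt.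
have db i : derivable ('D_(ei i) ('D_(ei i) Phi)) z et := D1 _ _ _ _ Oz (Cii i).
have dc i : derivable ('D_(ei i) Phi) z et := D1 _ _ _ _ Oz (Ci i).
have d0 : derivable Phi z et := D1 _ _ _ _ Oz C3.
have [da1 ea1] := derive_fscale gamma da; have [db1 eb1] := derive_fsum db.
have ds i : derivable (fun y => beta i * 'D_(ei i) Phi y) z et.
  by have [] := derive_fscale (beta i) (dc i).
have [dc1 ec1] := derive_fsum ds.
have [d01 e01] := derive_fscale alpha d0.
have [dab eab] := derive_fsub da1 db1; have [dc0 ec0] := derive_fadd d01 dc1.
have [_ e] := derive_fsub dab dc0; apply: etrans e _; congr (_ - _).
  apply: etrans eab _; congr (_ - _); first exact: ea1.
  by apply: etrans eb1 _; apply: eq_bigr => i _; exact: S2.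
apply: etrans ec0 _; congr (_ + _); first exact: e01.
apply: etrans ec1 _; apply: eq_bigr => i _.
have [_ ei'] := derive_fscale (beta i) (dc i); apply: etrans ei' _.
exact: (congr1 (fun r => beta i * r) (S1 i z Oz)).
Qed.

End Wave.

(** * Identities on the closed half-line of times *)

Section HalfLine.
Context {R : realType}.
Implicit Types (F G : R -> R).

(** At [t = 0] the functions may differ on the left, but both derivatives exist and so equal the
    common right derivative. *)
Lemma derive_half_line_eq F G t : 0 <= t -> (forall s, 0 <= s -> F s = G s) ->
  derivable F t 1 -> derivable G t 1 -> 'D_1 F t = 'D_1 G t.
Proof.
move=> t0 FG dF dG; have PF := within_ge0_proper t0.
rewrite -(derive_withinE (A := [set s : R | 0 <= s]) (f := F) PF dF)//; last exact: nearW.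
by apply: derive_withinE => //; [exact: nearW (fun s => FG _)|exact: FG].
Qed.

Lemma eq_at_zero F G : {for 0, continuous F} -> {for 0, continuous G} ->
  (forall s, 0 < s -> F s = G s) -> F 0 = G 0.
Proof.
rewrite /prop_for /continuous_at => cF cG FG.
have lF := cvg_at_right_filter cF.
have lG := cvg_at_right_filter cG.
apply: (cvg_unique (@norm_hausdorff _ _) lF).
apply: cvg_trans lG; apply: near_eq_cvg.
by near=> s; rewrite FG.
Unshelve. all: by end_near. Qed.

(** Only the single position [x] is involved. This serves [h], whose time extension depends on [x],
    and the data [G] at a boundary point, which has no neighbourhood inside the domain. *)
Lemma dt_half_line d (phi : 'rV[R]_d -> R -> R) F x t : 0 <= t -> derivable F t 1 ->
  (forall s, 0 <= s -> phi x s = F s) -> dt phi x t = 'D_1 F t.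
Proof.
by move=> t0 dF pF; apply: dtE => //; exact: (@filterE _ _ (nbhs_filter t) _ pF).
Qed.

End HalfLine.

Section Source.
Context {R : realType} {d : nat}.
Local Notation E := 'rV[R]_d.

Definition future : set (E * R) := [set z | 0 <= z.2].

Lemma future_slicewise_open : slicewise_open future.
Proof.
move=> x t t0; split; first exact: t0.
  exact: (@filterE _ _ (nbhs_filter x) _ (fun _ => t0)).
exact: (@filterE _ _ (nbhs_filter t) _ (fun _ s0 => s0)).
Qed.

Variables (a c p : E -> R) (B : E -> E) (f g : E -> R) (h u : E -> R -> R).
Variables (O : set (E * R)) (U : E * R -> R).
Hypotheses (oO : open O) (sO : future `<=` O) (CU : Ck_open O 4 U).
Hypothesis uU : agree future u U.
Hypothesis h_time : forall x, Ck_on [set t : R | 0 <= t] 3 (h x).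
Hypothesis u_sol : solves_hyperbolic a c B f g p h u.

Let fo := future_slicewise_open.
Let Ct : Ck_open O 3 ('D_et U) := Ck_open_derive et CU.

Lemma future_dt : agree future (dt u) ('D_et U).
Proof.
by apply: agree_dt uU _ => // z /sO Oz; exact: (Ck_open_derivable CU Oz).
Qed.

Lemma future_dt2 : agree future (dt (dt u)) ('D_et ('D_et U)).
Proof.
by apply: agree_dt future_dt _ => // z /sO Oz; exact: (Ck_open_derivable Ct Oz).
Qed.

(** The position [x] stays fixed: [h_time] extends [h x] to negative times separately for each [x],
    with no joint regularity. Once the operator is frozen at [x], the three claims are one identity
    between functions of time and its first two derivatives. *)
Lemma wave_source x t : 0 <= t ->
  let W := wave (c x) (a x) (B x 0) in
  [/\ W U (x, t) = p x * h x t,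
      W ('D_et U) (x, t) = p x * dt h x t &
      W ('D_et ('D_et U)) (x, t) = p x * dt (dt h) x t].
Proof.
move=> t0 W.
have [Uh [H [oUh sUh CH hH]]] := h_time x.
have oW k Phi : Ck_open O k.+2 Phi -> Ck_open O k (W Phi) by exact: Ck_open_wave.
have Ox s : 0 <= s -> O (x, s) by move=> s0; exact: sO.
have C1 : Ck_open Uh 2 ('D_1 H) := Ck_open_derive _ CH.
have dH s : 0 <= s -> derivable H s 1.
  by move=> s0; exact: (Ck_open_derivable CH (sUh _ s0)).
have dH1 s : 0 <= s -> derivable ('D_1 H) s 1.
  by move=> s0; exact: (Ck_open_derivable C1 (sUh _ s0)).
have h1 s : 0 <= s -> dt h x s = 'D_1 H s.
  by move=> s0; apply: (dt_half_line s0 (dH _ s0)) => r r0; rewrite hH.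
have h2 s : 0 <= s -> dt (dt h) x s = 'D_1 ('D_1 H) s.
  by move=> s0; exact: (dt_half_line s0 (dH1 _ s0) h1).
have pos s : 0 < s -> W U (x, s) = p x * H s.
  move=> s0; have s0' := ltW s0; have [/(_ x s s0) + _ _] := u_sol.
  have Nxs : future (x, s) by [].
  rewrite (future_dt2 Nxs) (agree_laplacian fo uU Nxs) (agree_grad fo uU Nxs).
  rewrite (uU Nxs) hH// => E; rewrite /W /wave E /dot.
  under eq_bigr do rewrite mxE.
  ring.
have CW0 : Ck_open O 2 (W U) := oW _ _ CU.
have CW1 : Ck_open O 1 (W ('D_et U)) := oW _ _ Ct.
(* The equation is not assumed at [s = 0]; both sides are continuous there. *)
have e0 s : 0 <= s -> W U (x, s) = p x * H s.
  rewrite le_eqVlt => /predU1P[<-|]; last exact: pos.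
  apply: (@eq_at_zero _ (fun s => W U (x, s)) (fun s => p x * H s)) => //.
    apply: continuous_slice2; exact: (Ck_open_continuous CW0 (Ox _ (lexx _))).
  apply: cvgM; first exact: cvg_cst.
  exact: (Ck_open_continuous CH (sUh _ (lexx _))).
have e1 s : 0 <= s -> W ('D_et U) (x, s) = p x * 'D_1 H s.
  move=> s0; apply: etrans (esym (derive_wave (c x) (a x) (B x 0) oO (Ox _ s0)
    (Ck_open_pred CU))) _.
  apply: etrans (esym (derive_slice2 (W U) x s)) _.
  have [d1 <-] := derive_fscale (p x) (dH s s0).
  have dW : derivable (fun r => W U (x, r)) s 1.
    by apply: derivable_slice2; exact: (Ck_open_derivable CW0 (Ox _ s0)).
  exact: (derive_half_line_eq s0 e0 dW d1).
have e2 s : 0 <= s -> W ('D_et ('D_et U)) (x, s) = p x * 'D_1 ('D_1 H) s.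
  move=> s0; apply: etrans (esym (derive_wave (c x) (a x) (B x 0) oO (Ox _ s0) Ct)) _.
  apply: etrans (esym (derive_slice2 (W ('D_et U)) x s)) _.
  have [d1 <-] := derive_fscale (p x) (dH1 s s0).
  have dW : derivable (fun r => W ('D_et U) (x, r)) s 1.
    by apply: derivable_slice2; exact: (Ck_open_derivable CW1 (Ox _ s0)).
  exact: (derive_half_line_eq s0 e1 dW d1).
split.
- by apply: etrans (e0 t t0) _; rewrite (hH t t0).
- by apply: etrans (e1 t t0) _; rewrite (h1 t t0).
- by apply: etrans (e2 t t0) _; rewrite (h2 t t0).
Qed.

End Source.

(** * The equation for the quotient *)

(** Sums the second-order product rule over the coordinates, giving the Laplacian of [V Q]; the
    middle factors are swapped to match the dot product of gradients in [lower_order]. *)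
Lemma sum_second_product (R : comRingType) n (v q : R) (a b e r : 'I_n -> R) :
  \sum_i (v * a i + 2 * b i * e i + q * r i) =
  v * \sum_i a i + 2 * (\sum_i e i * b i) + q * \sum_i r i.
Proof.
rewrite !mulr_sumr -!big_split/=; apply: eq_bigr => i _; ring.
Qed.

(* [v], [q], [vt], .. stand for the values of [V], [Q = 1/H] and their
   derivatives, [vl], [ql] for Laplacians, [bv] for [B . grad V] and [qv] for
   [grad Q . grad V]. *)
Lemma quotient_identity (R : fieldType) (a c r v vt vtt qt qtt vl ql bv qv htt w0 : R) :
  r != 0 ->
  c * (v * qtt + 2 * vt * qt + r^-1 * vtt) - (v * ql + 2 * qv + r^-1 * vl)
  - ((a * r * (v * r^-1) + bv) / r + c * (qtt * r + htt / r) * (v * r^-1)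
     + 2 * c * qt * vt - ql * r * (v * r^-1) - 2 * qv)
  + c * htt / r * (v * r^-1 - w0) =
  (c * vtt - vl - (a * v + bv)) / r - c * htt / r * w0.
Proof. by move=> r0; field. Qed.

Section Quotient.
Context {R : realType} {d : nat}.
Local Notation E := 'rV[R]_d.
Variables (a c : E -> R) (B : E -> E) (h ht w : E -> R -> R).
Variables (O N : set (E * R)) (V H : E * R -> R).
Hypotheses (oO : open O) (oN : slicewise_open N) (sN : N `<=` O).
Hypotheses (CV : Ck_open O 2 V) (CH : Ck_open O 2 H) (H0 : forall z, O z -> H z != 0).
Hypotheses (htH : agree N ht H) (wV : agree N w (fun z => V z / H z)).

Let Q (z : E * R) := (H z)^-1.
Let W (z : E * R) := V z * Q z.
Let CQ : Ck_open O 2 Q := Ck_openV oO H0 CH.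
Let CW : Ck_open O 2 W := Ck_openM oO CV CQ.

Lemma agree_dt_open k phi Phi : Ck_open O k.+1 Phi -> agree N phi Phi ->
  agree N (dt phi) ('D_et Phi).
Proof.
by move=> CP pP; apply: (agree_dt oN pP) => z /sN Oz; exact: (Ck_open_derivable CP Oz).
Qed.

(** [lower_order] is built to cancel every term in which a derivative falls on [1/H]. Its [h_tt]
    term cancels the upper end point of the integral of [w_t], so that only [w x 0] survives. *)
Lemma calL_quotient x t : (forall s, 0 <= s <= t -> N (x, s)) -> 0 <= t ->
  calL a c B h ht w x t =
  wave (c x) (a x) (B x 0) V (x, t) / H (x, t)
  - c x * dt (dt h) x t / H (x, t) * w x 0.
Proof.
move=> Ns t0.
have Nxt : N (x, t) by apply: Ns; rewrite lexx t0.
have Nx0 : N (x, 0) by apply: Ns; rewrite lexx t0.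
have Oxt : O (x, t) by exact: sN.
have Hn0 : H (x, t) != 0 by exact: H0.
have CW1 : Ck_open O 1 ('D_et W) := Ck_open_derive et CW.
have CQ1 : Ck_open O 1 ('D_et Q) := Ck_open_derive et CQ.
have wW : agree N w W by exact: wV.
have qQ : agree N (fun y s => (ht y s)^-1) Q by move=> y s Nys; rewrite (htH Nys).
have hV : agree N (fun y s => ht y s * w y s) V.
  move=> y s Nys; rewrite (htH Nys) (wW _ _ Nys) /W /Q.
  by rewrite mulrCA mulfV ?mulr1//; exact/H0/sN.
have wt := agree_dt_open CW wW.
have e_wtt := agree_dt_open CW1 wt Nxt.
have e_wl := agree_laplacian oN wW Nxt.
have qt := agree_dt_open CQ qQ.
have e_qt := qt _ _ Nxt.
have e_qtt := agree_dt_open CQ1 qt Nxt.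
have e_ql := agree_laplacian oN qQ Nxt.
have e_qg := agree_grad oN qQ Nxt.
have e_vt := agree_dt_open CV hV Nxt.
have e_vg := agree_grad oN hV Nxt.
have e_int : \int[lebesgue_measure]_(tau in `[0, t]) dt w x tau = W (x, t) - W (x, 0).
  have OU s : 0 <= s <= t -> O (x, s) by move=> /Ns; exact: sN.
  rewrite -(Rintegral_derive_slice oO (Ck_open_pred CW) t0 OU).
  by apply: eq_Rintegral => s; rewrite inE/= in_itv/= => /Ns Nxs; exact: wt.
have e_tt := deriveM_second et oO Oxt CV CQ.
have e_ii i := deriveM_second (ei i) oO Oxt CV CQ.
have e_l := etrans e_wl (etrans (eq_bigr _ (fun i _ => e_ii i))
  (sum_second_product _ _ _ _ _ _)).
have e_B : dot (B x) (grad ((fun y s => ht y s * w y s)^~ t) x) =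
    \sum_i B x 0 i * 'D_(ei i) V (x, t).
  by rewrite e_vg; apply: eq_bigr => i _; rewrite mxE.
have e_QV : dot (grad ((fun y s => (ht y s)^-1)^~ t) x)
      (grad ((fun y s => ht y s * w y s)^~ t) x) =
    \sum_i 'D_(ei i) Q (x, t) * 'D_(ei i) V (x, t).
  by rewrite e_qg e_vg; apply: eq_bigr => i _; rewrite !mxE.
rewrite /calL /lower_order e_int e_B e_QV (etrans e_wtt e_tt) e_l e_qtt e_qt e_ql e_vt.
rewrite (htH Nxt) (wW _ _ Nxt) (wW _ _ Nx0).
exact: quotient_identity.
Qed.

End Quotient.

Lemma wave_agree (R : realType) d (N : set ('rV[R]_d * R)) gamma alpha (b : 'rV[R]_d)
    phi (Phi : 'rV[R]_d * R -> R) x t (s : R) :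
  slicewise_open N -> agree N phi Phi -> N (x, t) ->
  wave gamma alpha (b 0) Phi (x, t) = s ->
  gamma * 'D_et ('D_et Phi) (x, t) =
  laplacian (phi^~ t) x + alpha * phi x t + dot b (grad (phi^~ t) x) + s.
Proof.
move=> oN pP Nxt <-; rewrite (agree_laplacian oN pP Nxt) (agree_grad oN pP Nxt) (pP _ _ Nxt).
have -> : dot b (\row_i 'D_(ei i) Phi (x, t)) = \sum_i b 0 i * 'D_(ei i) Phi (x, t).
  by apply: eq_bigr => i _; rewrite mxE.
rewrite /wave; move: ('D_et _ _) (\sum_i _) (\sum_i _) (Phi _) => k l m n; ring.
Qed.

(** Replacing [L] by [c v0 - p h0] makes the terms in [v0] match, with no need to solve for [p]. *)
Lemma source_elimination (R : fieldType) (p htt c r v0 h0 L : R) : c * v0 = L + p * h0 ->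
  h0 != 0 -> r != 0 -> p * htt / r - c * htt / r * (v0 / h0) = - (htt * L) / (h0 * r).
Proof.
move=> E h0n rn; have -> : L = c * v0 - p * h0 by rewrite E addrK.
by field; rewrite rn h0n.
Qed.

(** The left-hand side is the product rule for [V * H^-1], in the form in which it arises. *)
Lemma initial_velocity (R : fieldType) (p c v0 v1 h0 h1 L0 L1 : R) :
  c * v0 = L0 + p * h0 -> c * v1 = L1 + p * h1 -> c != 0 -> h0 != 0 ->
  v0 * (- h0 ^- 2 * h1) + h0^-1 * v1 = (L1 * h0 - L0 * h1) / (c * h0 ^+ 2).
Proof.
move=> E0 E1 cn h0n; have -> : L0 = c * v0 - p * h0 by rewrite E0 addrK.
have -> : L1 = c * v1 - p * h1 by rewrite E1 addrK.
by field; rewrite cn h0n.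
Qed.

(** * Normal derivatives at the boundary *)

Section Normal.
Context {R : realType} {d : nat}.
Local Notation E := 'rV[R]_d.
Implicit Types (Omega : set E) (x n : E).

(** As [n] is a unit vector and the gradient of [rho] is [lambda n], the derivative of [rho] along
    [n] is [lambda > 0]; a small step backwards makes [rho] negative. *)
Lemma outward_normal_inside Omega x n : outward_unit_normal Omega x n ->
  \forall s \near (0 : R)^', s < 0 -> Omega (x + s *: n).
Proof.
move=> [nn1 [U [rho [lambda [[oU Ux Crho] [OmegaE rho0 lambda0 gradE]]]]]].
have C1 := Crho 1%N.
have drho : derivable rho x n by exact: (Ck_open_derivable C1 Ux).
have Dn : 'D_n rho x = lambda.
  rewrite [n in LHS]row_sum_delta (derive_sum_dir _ _ oU Ux C1).
  rewrite -[RHS]mulr1 -nn1 mulr_sumr; apply: eq_bigr => i _.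
  have /rowP/(_ i) := gradE; rewrite !mxE /partial => ->; ring.
have D0 : 0 < 'D_n rho x by rewrite Dn.
have nU : \forall s \near (0 : R)^', U (x + s *: n).
  by apply: nbhs_dnbhs; exact: (cvg_line n (open_nbhs_nbhs (conj oU Ux))).
apply: filterS2 nU (derive_gt0_near drho D0) => s Us ns s0.
by apply/(OmegaE _ Us); rewrite -rho0; exact: ns.
Qed.

Lemma near_dnbhs0_neg (P : set R) : (\forall s \near (0 : R)^', s < 0 -> P s) ->
  exists2 s, s < 0 & P s.
Proof.
move=> [e /= e0 eP]; exists (- (e / 2)).
  by rewrite oppr_lt0 divr_gt0.
have e20 : 0 < e / 2 by rewrite divr_gt0.
apply: eP => /=; last by rewrite oppr_lt0.
  rewrite /ball_ sub0r opprK gtr0_norm// ltr_pdivrMr// mulr_natr mulr2n ltrDl//.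
by rewrite oppr_eq0 gt_eqF.
Qed.

(** Inward steps are admissible, so the limit defining [normal_derivative] is taken along a proper
    filter. *)
Lemma within_closure_proper Omega x n : outward_unit_normal Omega x n ->
  ProperFilter (within [set s : R | closure Omega (x + s *: n)] 0^').
Proof.
move=> xn; apply: Build_ProperFilter_ex => P nP.
have n2 : \forall s \near (0 : R)^', s < 0 -> P s.
  have nP' : \forall s \near (0 : R)^', closure Omega (x + s *: n) -> P s by exact: nP.
  apply: filterS2 nP' (outward_normal_inside xn) => s Ps Os s0.
  exact/Ps/subset_closure/Os.
by have [s _ Ps] := near_dnbhs0_neg n2; exists s.
Qed.

Lemma smooth_boundary_closure Omega x : smooth_boundary Omega x -> closure Omega x.
Proof.
move=> [n xn] P nP.
have nP' : \forall s \near (0 : R)^', P (x + s *: n).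
  by apply: nbhs_dnbhs; exact: (cvg_line n nP).
have n2 : \forall s \near (0 : R)^', s < 0 -> (Omega `&` P) (x + s *: n).
  apply: filterS2 nP' (outward_normal_inside xn) => s Ps Os s0.
  by split; [exact: Os|].
by have [s _ Ps] := near_dnbhs0_neg n2; exists (x + s *: n).
Qed.

Lemma normal_derivativeE Omega (nu : E -> E) (phi : E -> R) (Phi : E * R -> R) x t :
  outward_unit_normal Omega x (nu x) -> closure Omega x ->
  derivable Phi (x, t) (nu x, 0) ->
  (forall y, closure Omega y -> phi y = Phi (y, t)) ->
  normal_derivative Omega nu phi x = 'D_(nu x, 0) Phi (x, t).
Proof.
move=> xn Ox dP pP; rewrite -derive_slice1.
apply: derive_withinE.
- exact: within_closure_proper.
- exact: derivable_slice1.
- apply: (@filterE _ _ (@dnbhs_filter R 0)) => s; exact: pP.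
- exact: pP.
Qed.

End Normal.

Unset Implicit Arguments.
Set Strict Implicit.

Theorem proposition3p1 (R : realType) (d : nat)
    (a c : 'rV[R]_d -> R) (B : 'rV[R]_d -> 'rV[R]_d)
    (f g p : 'rV[R]_d -> R) (h ht u : 'rV[R]_d -> R -> R)
    (Omega : set 'rV[R]_d) (nu : 'rV[R]_d -> 'rV[R]_d) (T : R)
    (hd : (2 <= d)%N)
    (a_reg : Ck_open setT ((d.+1)./2 + 3) a)
    (c_reg : Ck_open setT ((d.+1)./2 + 3) c)
    (B_reg : Ck_open setT ((d.+1)./2 + 3) B)
    (c_supp : compactly_supported (fun x => c x - 1))
    (a_supp : compactly_supported a)
    (B_supp : compact (closure [set x | B x != 0]))
    (c_pos : forall x, 0 < c x)
    (f_reg : sobolev_H ((d.+1)./2 + 5) f)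
    (g_reg : sobolev_H ((d.+1)./2 + 5) g)
    (f_supp : compactly_supported f)
    (g_supp : compactly_supported g)
    (h_space : forall t, 0 < t -> Ck_open setT ((d.+1)./2 + 1) (h^~ t))
    (h_time : forall x, Ck_on [set t : R | 0 <= t] 3 (h x))
    (dom : piecewise_smooth_bounded_domain Omega)
    (nuP : forall x, smooth_boundary Omega x ->
       outward_unit_normal Omega x (nu x))
    (T_pos : 0 < T)
    (h0_neq0 : forall x, Omega x -> 0 < `|h x 0|)
    (ht_smooth : smooth_on [set z : 'rV[R]_d * R | closure Omega z.1 /\ 0 <= z.2]
       (fun z : 'rV[R]_d * R => ht z.1 z.2))
    (ht0 : forall x, Omega x -> ht x 0 = h x 0)
    (dt_ht0 : forall x, Omega x -> dt ht x 0 = dt h x 0)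
    (ht_neq0 : forall x t, closure Omega x -> 0 <= t <= T -> ht x t != 0)
    (u_reg : Ck_on [set z : 'rV[R]_d * R | 0 <= z.2] 4
       (fun z : 'rV[R]_d * R => u z.1 z.2))
    (u_sol : solves_hyperbolic a c B f g p h u) :
  let w := fun x t => dt (dt u) x t / ht x t in
  let F := fun x t => u x t in
  let G := fun x t => normal_derivative Omega nu (u^~ t) x in
  [/\ forall x t, Omega x -> 0 <= t <= T ->
        calL a c B h ht w x t = calF a B h ht f x t,
      forall x, Omega x -> dt w x 0 = Psi a c B h f g x,
      forall x t, boundary Omega x -> 0 <= t <= T ->
        w x t = zeta ht F x t &
      forall x t, smooth_boundary Omega x -> 0 <= t <= T ->
        normal_derivative Omega nu (w^~ t) x = xi ht Omega nu F G x t].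
Proof.
move=> w F G.
have [U4 [U [oU sU CU uU]]] := u_reg.
have [UH [H [oH sH CH hH]]] := ht_smooth 2%N.
have [oOmega _ _ _ _] := dom.
(* The extension [H] may vanish away from the closed cylinder up to time [T]; by continuity,
   removing its zeros leaves an open set. *)
pose O := U4 `&` UH `&` [set z | H z != 0].
have OU : O `<=` U4 by move=> z [[]].
have OH : O `<=` UH by move=> z [[]].
have H0 z : O z -> H z != 0 by case.
have oO : open O.
  rewrite openE => z [[Uz Hz] Hz0].
  apply: filterI; first by apply: filterI; exact: open_nbhs_nbhs.
  exact: (cvgr_neq0 _ (Ck_open_continuous CH Hz) Hz0).
(* Times are not cut at [T]: [dt] at [t = T] also looks at later times, where [O] still keeps [H]
   away from zero. *)
pose N : set ('rV[R]_d * R) := [set z | [/\ Omega z.1, 0 <= z.2 & O z]].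
have sN : N `<=` O by move=> z [].
have oN : slicewise_open N.
  move=> x t [/= Ox t0 Oxt]; split => //.
    apply: filterS2 (open_nbhs_nbhs (conj oOmega Ox)) (near_slice1 (open_nbhs_nbhs (conj oO Oxt))).
    by move=> y Oy Oyt.
  by apply: filterS (near_slice2 (open_nbhs_nbhs (conj oO Oxt))) => s Os s0.
have uE : agree future u U by move=> x t t0; rewrite (uU (x, t)).
have CUt : Ck_open U4 3 ('D_et U) := Ck_open_derive et CU.
pose V := 'D_et ('D_et U).
have CUtt : Ck_open U4 2 V := Ck_open_derive et CUt.
have utt : agree future (dt (dt u)) V by exact: (future_dt2 sU CU uE).
have htE x t : closure Omega x -> 0 <= t -> ht x t = H (x, t).
  by move=> cx t0; rewrite -(hH (x, t)).
have wE x t : closure Omega x -> 0 <= t -> w x t = V (x, t) / H (x, t).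
  by move=> cx t0; rewrite /w (htE _ _ cx t0) utt.
have CV : Ck_open O 2 V := Ck_open_subset OU CUtt.
have CHO : Ck_open O 2 H := Ck_open_subset OH CH.
have htN : agree N ht H.
  by move=> x t [/= Ox t0 _]; apply: htE => //; exact: subset_closure.
have wN : agree N w (fun z => V z / H z).
  by move=> x t [/= Ox t0 _]; apply: wE => //; exact: subset_closure.
have inO x t : closure Omega x -> 0 <= t <= T -> O (x, t).
  move=> cx /andP[t0 tT]; split; last first.
    by rewrite /= -htE// ht_neq0// t0.
  by split; [exact: sU|exact: sH].
have inN x t : Omega x -> 0 <= t <= T -> N (x, t).
  by move=> Ox tT; split => //; [case/andP : tT|apply: inO => //; exact: subset_closure].
have T0 : 0 <= (0 : R) <= T by rewrite lexx ltW.
have src x t t0 := @wave_source _ _ a c p B f g h u U4 U oU sU CU uE h_time u_sol x t t0.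
have [_ u0 ut0] := u_sol.
(* As traces of [u] and [dt u] at time 0, [f] and [g] inherit classical space derivatives from [U]
   and ['D_et U]. *)
have fE : f = u^~ 0 by apply/funext => x; rewrite u0.
have gE : g = (dt u)^~ 0 by apply/funext => x; rewrite ut0.
have fo := @future_slicewise_open R d.
have F0 (x : 'rV[R]_d) : future (x, 0 : R) by exact: lexx.
have init0 x : c x * V (x, 0) =
    laplacian f x + a x * f x + dot (B x) (grad f x) + p x * h x 0.
  by have [e _ _] := src x 0 (lexx _); rewrite fE; exact: (wave_agree fo uE (F0 x) e).
have init1 x : c x * 'D_et V (x, 0) =
    laplacian g x + a x * g x + dot (B x) (grad g x) + p x * dt h x 0.
  have [_ e _] := src x 0 (lexx _); rewrite gE.
  exact: (wave_agree fo (future_dt sU CU uE) (F0 x) e).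
have h0n x : Omega x -> h x 0 != 0 by move=> /h0_neq0; rewrite normr_gt0.
have Hh x : Omega x -> H (x, 0) = h x 0.
  by move=> Ox; rewrite -htE ?ht0//; exact: subset_closure.
have w0E x : Omega x -> w x 0 = V (x, 0) / h x 0.
  by move=> Ox; rewrite wE ?Hh//; exact: subset_closure.
split.
- move=> x t Ox tT; have /andP[t0 _] := tT.
  rewrite (calL_quotient a c B h oO oN sN CV CHO H0 htN wN)//; last first.
    by move=> s /andP[s0 st]; apply: inN => //; rewrite s0 (le_trans st)//; case/andP : tT.
  have [_ _ ->] := src x t t0.
  rewrite (w0E _ Ox) /calF (htN _ _ (inN _ _ Ox tT)).
  by apply: source_elimination => //; [exact: h0n|apply: H0; exact: sN (inN _ _ Ox tT)].
- move=> x Ox.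
  have Nx := inN _ _ Ox T0; have Ox0 := sN _ Nx.
  have CQ : Ck_open O 2 (fun z => (H z)^-1) := Ck_openV oO H0 CHO.
  have CW : Ck_open O 2 (fun z => V z / H z) := Ck_openM oO CV CQ.
  have dV : derivable V (x, 0) et := Ck_open_derivable CV Ox0.
  have dH : derivable H (x, 0) et := Ck_open_derivable CHO Ox0.
  have dQ : derivable (fun z => (H z)^-1) (x, 0) et := Ck_open_derivable CQ Ox0.
  have [_ eW] := derive_fmul dV dQ.
  have eH : 'D_et H (x, 0) = dt h x 0.
    by rewrite -dt_ht0//; exact: esym (agree_dt_open oN sN CHO htN Nx).
  apply: etrans (agree_dt_open oN sN CW wN Nx) _.
  apply: etrans eW _.
  rewrite (deriveV (H0 _ Ox0) dH) eH (Hh _ Ox).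
  exact: (initial_velocity (init0 x) (init1 x) (lt0r_neq0 (c_pos x)) (h0n _ Ox)).
(* [F] is [u] itself, so [zeta] unfolds to [w]. *)
- by [].
- move=> x t sx tT; have /andP[t0 _] := tT.
  have xn := nuP _ sx; have cx := smooth_boundary_closure sx.
  have Oxt := inO _ _ cx tT; have Uxt := OU _ Oxt.
  pose n : 'rV[R]_d * R := (nu x, 0).
  have CQ : Ck_open O 2 (fun z => (H z)^-1) := Ck_openV oO H0 CHO.
  have CW : Ck_open O 2 (fun z => V z / H z) := Ck_openM oO CV CQ.
  have dV : derivable V (x, t) n := Ck_open_derivable CV Oxt.
  have dH : derivable H (x, t) n := Ck_open_derivable CHO Oxt.
  have dQ : derivable (fun z => (H z)^-1) (x, t) n := Ck_open_derivable CQ Oxt.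
  have dW : derivable (fun z => V z / H z) (x, t) n := Ck_open_derivable CW Oxt.
  have [_ eW] := derive_fmul dV dQ.
  have ew : normal_derivative Omega nu (w^~ t) x = 'D_n (fun z => V z / H z) (x, t).
    by apply: normal_derivativeE => // y cy; exact: wE.
  have eht : normal_derivative Omega nu (ht^~ t) x = 'D_n H (x, t).
    by apply: normal_derivativeE => // y cy; exact: htE.
  have CnU : Ck_open U4 3 ('D_n U) := Ck_open_derive n CU.
  have CntU : Ck_open U4 2 ('D_et ('D_n U)) := Ck_open_derive et CnU.
  have Us s : 0 <= s -> U4 (x, s) by move=> s0; exact: sU.
  (* [G] is identified on the whole half-line, so that [dt] can be applied to it twice at every time
     up to and including [T]. *)
  have eG s : 0 <= s -> G x s = 'D_n U (x, s).
    move=> s0; apply: normal_derivativeE => //.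
      exact: (Ck_open_derivable CU (Us _ s0)).
    by move=> y _; exact: uE.
  have eG1 s : 0 <= s -> dt G x s = 'D_et ('D_n U) (x, s).
    move=> s0; apply: etrans (derive_slice2 ('D_n U) x s).
    have dG := derivable_slice2 (Ck_open_derivable (v := et) CnU (Us _ s0)).
    exact: (dt_half_line s0 dG eG).
  have eG2 : dt (dt G) x t = 'D_et ('D_et ('D_n U)) (x, t).
    apply: etrans (derive_slice2 ('D_et ('D_n U)) x t).
    have dG := derivable_slice2 (Ck_open_derivable (v := et) CntU (Us _ t0)).
    exact: (dt_half_line t0 dG eG1).
  have sym1 z : U4 z -> 'D_et ('D_n U) z = 'D_n ('D_et U) z.
    move=> Uz; exact: (derivative_symmetric et n oU Uz (Ck_open_le (isT : (2 <= 4)%N) CU)).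
  (* The normal derivative is moved past the two time derivatives one at a time; the first exchange
     holds on all of [U4] and can therefore be differentiated. *)
  have sym2 : 'D_et ('D_et ('D_n U)) (x, t) = 'D_n V (x, t).
    apply: etrans (eq_derive_open et oU Uxt sym1) _.
    exact: (derivative_symmetric et n oU Uxt (Ck_open_pred CUt)).
  have Hn0 := H0 _ Oxt.
  rewrite /xi eht eG2 sym2 (utt _ _ t0) (htE _ _ cx t0).
  apply: etrans ew _; apply: etrans eW _.
  rewrite (deriveV Hn0 dH) -[_ *: _]/(_ * _).
  move: ('D_n V _) ('D_n H _) (V _) (H _) Hn0 => k l m r rn0.
  by field.
Qed.
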